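(* Let $Q(x)$ be a potential on $\mathbb{R}$, smooth and rapidly decreasing as $|x|\to\infty$, with values in $so(9)$, of the block form $$Q=\begin{pmatrix}0&\boldsymbol q&0\\ \boldsymbol p&0&\tilde{\boldsymbol q}\\ 0&\tilde{\boldsymbol p}&0\end{pmatrix}$$ (all blocks $3\times3$), satisfying $Q=Q^\dagger$ and $A_1QA_1^{-1}=Q$. Let $T(\lambda)$, $\lambda\in\mathbb{R}$, be the scattering matrix of $L=i\partial_x+Q(x)-\lambda J$. Then $$T^{-1}(\lambda)=S_0T^T(\lambda)S_0,\qquad T^\dagger(\lambda^* )=T^{-1}(\lambda),\qquad T(\lambda)=A_1T(\lambda)A_1^{-1}.$$ Consequently, writing $$T(\lambda)=\begin{pmatrix}\boldsymbol m^+&-\boldsymbol b^-&\boldsymbol c^-\\ \boldsymbol b^+&\boldsymbol T_{22}&-\boldsymbol B^-\\ \boldsymbol c^+&\boldsymbol B^+&\boldsymbol m^-\end{pmatrix}$$ in $3\times3$ blocks, one has $$\boldsymbol m^{+,\dagger}(\lambda^* )=s_1\boldsymbol m^{-,T}(\lambda)s_1,\qquad \boldsymbol c^{+,\dagger}(\lambda^* )=s_1\boldsymbol c^{-,T}(\lambda)s_1,$$ $$\boldsymbol b^{\pm,\dagger}(\lambda^* )=s_1\boldsymbol B^{\mp,T}(\lambda)s_1,\qquad \boldsymbol B^{\pm,\dagger}(\lambda^* )=s_1\boldsymbol b^{\mp,T}(\lambda)s_1,$$ and $$\boldsymbol m^+=a_1\boldsymbol m^+a_1^{-1},\quad \boldsymbol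 b^-=a_1\boldsymbol b^-a_2^{-1},\quad \boldsymbol c^-=a_1\boldsymbol c^-a_3^{-1},$$ $$\boldsymbol b^+=a_2\boldsymbol b^+a_1^{-1},\quad \boldsymbol T_{22}=a_2\boldsymbol T_{22}a_2^{-1},\quad \boldsymbol B^-=a_2\boldsymbol B^-a_3^{-1},$$ $$\boldsymbol c^+=a_3\boldsymbol c^+a_1^{-1},\quad \boldsymbol B^+=a_3\boldsymbol B^+a_2^{-1},\quad \boldsymbol m^-=a_3\boldsymbol m^-a_3^{-1}.$$
   Context: $^*$ is complex conjugation (for real $\lambda$, $\lambda^*=\lambda$), $^\dagger$ Hermitian conjugation. $so(9)$ is the Lie algebra of complex $9\times9$ matrices $X$ with $X+S_0X^TS_0^{-1}=0$, where, in $3\times3$ blocks, $$S_0=\begin{pmatrix} 0 & 0 & s_1 \\ 0 & -s_1 & 0 \\ {s_1} & 0 & 0 \end{pmatrix},\qquad s_1=\begin{pmatrix} 0 & 0 & 1 \\ 0 & -1 & 0 \\ 1 & 0 & 0 \end{pmatrix},\qquad J=\mathrm{diag}(\mathbb{1}_3,0_3,-\mathbb{1}_3).$$ $A_1=\mathrm{diag}(a_1,a_2,a_3)$ (block diagonal) with $$a_1=\begin{pmatrix} 0 & 1 & 0 \\ 0 & 0 & 1 \\ -1 & 0 & 0 \end{pmatrix},\quad a_2=\begin{pmatrix} 0 & 0 & 1 \\ 0 & -1 & 0 \\ 1 & 0 & 0 \end{pmatrix},\quad a_3=\begin{pmatrix} 0 & 0 & -1 \\ -1 & 0 & 0 \\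 0 & -1 & 0 \end{pmatrix}.$$ For $\lambda\in\mathbb{R}$ the Jost solutions $\phi(x,\lambda),\psi(x,\lambda)$ are the fundamental matrix solutions of $i\partial_x\chi+(Q(x)-\lambda J)\chi=0$ with $\lim_{x\to-\infty}\phi(x,\lambda)e^{i\lambda Jx}=\mathbb{1}$ and $\lim_{x\to+\infty}\psi(x,\lambda)e^{i\lambda Jx}=\mathbb{1}$. The scattering matrix is $T(\lambda)=\psi^{-1}(x,\lambda)\phi(x,\lambda)$ (independent of $x$). *)

(* Defs.v *)
From HB Require Import structures.
From mathcomp Require Import all_boot all_order all_algebra.
From mathcomp Require Import complex.
From mathcomp Require Import all_classical all_reals all_analysis.
Import Order.TTheory GRing.Theory Num.Theory numFieldNormedType.Exports.

Set Implicit Arguments.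
Unset Strict Implicit.
Unset Printing Implicit Defensive.

Local Open Scope classical_set_scope.
Local Open Scope ring_scope.
Local Open Scope complex_scope.
Local Open Scope sesquilinear_scope.

(* Throughout, R : realType is the real line and R[i] its complexification;
   A ^t* is the Hermitian conjugate of A, A^T its transpose. *)

(* The library puts the topology given by the norm on abstract numFieldTypes
   only; this makes it available on R[i], hence on matrices over R[i]. *)
HB.instance Definition _ (R : realType) :=
  NormedModule.copy R[i] (R[i] : numFieldType)^o.

Section Blocks.
Variable K : nmodType.

Definition mx3 (rows : seq (seq K)) : 'M[K]_3 :=
  \matrix_(i, j) nth 0 (nth [::] rows i) j.

Definition block3 (A11 A12 A13 A21 A22 A23 A31 A32 A33 : 'M[K]_3)
    : 'M[K]_(3 + 3 + 3) :=
  block_mx (block_mx A11 A12 A21 A22) (col_mx A13 A23)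
           (row_mx A31 A32)           A33.

End Blocks.

Section Constants.
Variable R : realType.
Local Notation C := R[i].

Definition s1 : 'M[C]_3 :=
  mx3 [:: [:: 0; 0; 1];
          [:: 0; -1; 0];
          [:: 1; 0; 0]].

Definition S0 : 'M[C]_(3 + 3 + 3) :=
  block3 0  0     s1
         0  (-s1) 0
         s1 0     0.

Definition J : 'M[C]_(3 + 3 + 3) :=
  block3 1%:M 0 0
         0    0 0
         0    0 (-1%:M).

Definition a1 : 'M[C]_3 :=
  mx3 [:: [:: 0; 1; 0];
          [:: 0; 0; 1];
          [:: -1; 0; 0]].

Definition a2 : 'M[C]_3 :=
  mx3 [:: [:: 0; 0; 1];
          [:: 0; -1; 0];
          [:: 1; 0; 0]].

Definition a3 : 'M[C]_3 :=
  mx3 [:: [:: 0; 0; -1];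
          [:: -1; 0; 0];
          [:: 0; -1; 0]].

Definition A1 : 'M[C]_(3 + 3 + 3) :=
  block3 a1 0  0
         0  a2 0
         0  0  a3.

Definition in_so9 (X : 'M[C]_(3 + 3 + 3)) : Prop :=
  X + S0 *m X^T *m invmx S0 = 0.

(* e^(i t) for real t *)
Definition cis (t : R) : C := cos t +i* sin t.

(* e^(i t J): J is diagonal, with entries 1, 0 and -1, each three times. *)
Definition expiJ (t : R) : 'M[C]_(3 + 3 + 3) :=
  block3 (cis t)%:M 0    0
         0          1%:M 0
         0          0    (cis (- t))%:M.

End Constants.

Section Scattering.
Variable R : realType.
Local Notation C := R[i].

(* The library has no derivative of a complex-valued function of a real
   variable, so calculus is done on real and imaginary parts. *)
Definition is_derive_mx m n (F : R -> 'M[C]_(m, n)) (x : R)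
    (D : 'M[C]_(m, n)) : Prop :=
  forall i j,
    is_derive x 1 (fun y => complex.Re (F y i j)) (complex.Re (D i j)) /\
    is_derive x 1 (fun y => complex.Im (F y i j)) (complex.Im (D i j)).

Definition smooth (f : R -> R) : Prop :=
  forall (k : nat) (x : R), derivable (derive1n k f) x 1.

Definition smooth_mx m n (F : R -> 'M[C]_(m, n)) : Prop :=
  forall i j, smooth (fun y => complex.Re (F y i j)) /\
              smooth (fun y => complex.Im (F y i j)).

(* decay faster than every power of x, at both ends of the line *)
Definition rapidly_decreasing_mx m n (F : R -> 'M[C]_(m, n)) : Prop :=
  forall k : nat,
    ((x%:C) ^+ k *: F x @[x --> +oo] --> (0 : 'M[C]_(m, n))) /\
    ((x%:C) ^+ k *: F x @[x --> -oo] --> (0 : 'M[C]_(m, n))).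

(* chi is a fundamental matrix solution of
   i chi' + (Q - lambda J) chi = 0 on the whole line. *)
Definition fundamental_solution (Q : R -> 'M[C]_(3 + 3 + 3)) (lambda : R)
    (chi : R -> 'M[C]_(3 + 3 + 3)) : Prop :=
  (forall x, exists2 D, is_derive_mx chi x D &
     'i *: D + (Q x - lambda%:C *: J R) *m chi x = 0) /\
  (forall x, chi x \in unitmx).

Definition is_jost_phi (Q : R -> 'M[C]_(3 + 3 + 3))
    (phi : R -> R -> 'M[C]_(3 + 3 + 3)) : Prop :=
  forall lambda : R,
    fundamental_solution Q lambda (phi^~ lambda) /\
    (phi x lambda *m expiJ (lambda * x) @[x --> -oo]
       --> (1%:M : 'M[C]_(3 + 3 + 3))).

Definition is_jost_psi (Q : R -> 'M[C]_(3 + 3 + 3))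
    (psi : R -> R -> 'M[C]_(3 + 3 + 3)) : Prop :=
  forall lambda : R,
    fundamental_solution Q lambda (psi^~ lambda) /\
    (psi x lambda *m expiJ (lambda * x) @[x --> +oo]
       --> (1%:M : 'M[C]_(3 + 3 + 3))).

(* The scattering matrix psi^-1(x, lambda) phi(x, lambda); for Jost solutions
   it does not depend on the point x. *)
Definition scattering_matrix (phi psi : R -> R -> 'M[C]_(3 + 3 + 3))
    (x lambda : R) : 'M[C]_(3 + 3 + 3) :=
  invmx (psi x lambda) *m phi x lambda.

End Scattering.

(* Main.v *)
Require Import Defs.
From HB Require Import structures.
From mathcomp Require Import all_boot all_order all_algebra.
From mathcomp Require Import complex ring.
From mathcomp Require Import all_classical all_reals all_analysis.
Import Order.TTheory GRing.Theory Num.Theory numFieldNormedType.Exports.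

Set Implicit Arguments.
Unset Strict Implicit.
Unset Printing Implicit Defensive.

Local Open Scope ring_scope.
Local Open Scope complex_scope.
Local Open Scope sesquilinear_scope.

(** Let [s] be the identity or complex conjugation of [R[i]], and [M] a constant
    matrix with [s('i) H^s M + 'i M H = 0] for [H = Q - lambda J], where [A^s] is
    the transpose of [A] with [s] applied to its entries.  Then [chi^s M chi] is
    constant for every solution [chi].  If moreover [M] is invariant under the
    unitary [expiJ], the normalization at infinity forces this constant to be [M],
    for both Jost solutions, whence [T^s M T = M].  The three symmetries are the
    cases ([s] identity, [M = S0]), ([s] conjugation, [M = 1]) and
    ([s] conjugation, [M = A1]). *)

(** * Derivatives of complex matrix functions of a real variable *)

Section Calculus.
Variable R : realType.
Local Notation C := R[i].

(** This is exactly what [is_derive_mx] asks of each entry, so that scalar rules lift to matrices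
    entry by entry. *)
Definition is_derive_complex (f : R -> C) (x : R) (d : C) : Prop :=
  is_derive x 1 (fun y => complex.Re (f y)) (complex.Re d) /\
  is_derive x 1 (fun y => complex.Im (f y)) (complex.Im d).

Lemma is_derive_complexM (f g : R -> C) x d e :
  is_derive_complex f x d -> is_derive_complex g x e ->
  is_derive_complex (fun y => f y * g y) x (d * g x + f x * e).
Proof.
move=> [df1 df2] [dg1 dg2].
have ReM (a b : C) : complex.Re (a * b) =
    complex.Re a * complex.Re b - complex.Im a * complex.Im b.
  by case: a b => [? ?] [? ?].
have ImM (a b : C) : complex.Im (a * b) =
    complex.Re a * complex.Im b + complex.Im a * complex.Re b.
  by case: a b => [? ?] [? ?].
split.
- rewrite (_ : (fun y => _) =
    (fun y => complex.Re (f y)) * (fun y => complex.Re (g y)) -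
    (fun y => complex.Im (f y)) * (fun y => complex.Im (g y))); last first.
    by apply/funext => y; rewrite ReM.
  by apply: is_derive_eq; rewrite [RHS]raddfD /= !ReM /GRing.scale /=; ring.
- rewrite (_ : (fun y => _) =
    (fun y => complex.Re (f y)) * (fun y => complex.Im (g y)) +
    (fun y => complex.Im (f y)) * (fun y => complex.Re (g y))); last first.
    by apply/funext => y; rewrite ImM.
  by apply: is_derive_eq; rewrite [RHS]raddfD /= !ImM /GRing.scale /=; ring.
Qed.

Lemma is_derive_complex_sum n (f : 'I_n -> R -> C) x (d : 'I_n -> C) :
  (forall k, is_derive_complex (f k) x (d k)) ->
  is_derive_complex (fun y => \sum_k f k y) x (\sum_k d k).
Proof.
move=> df; split; rewrite raddf_sum.
- rewrite (_ : (fun y => _) = \sum_k (fun y => complex.Re (f k y))).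
    by apply: is_derive_sum => k; have [] := df k.
  by apply/funext => y; rewrite raddf_sum fct_sumE.
- rewrite (_ : (fun y => _) = \sum_k (fun y => complex.Im (f k y))).
    by apply: is_derive_sum => k; have [] := df k.
  by apply/funext => y; rewrite raddf_sum fct_sumE.
Qed.

Lemma is_derive_complex_conj (f : R -> C) x d :
  is_derive_complex f x d ->
  is_derive_complex (fun y => Num.conj (f y)) x (Num.conj d).
Proof.
have ReJ (z : C) : complex.Re (Num.conj z) = complex.Re z by case: z.
have ImJ (z : C) : complex.Im (Num.conj z) = - complex.Im z by case: z.
move=> [df1 df2]; split.
- by rewrite ReJ (_ : (fun y => _) = fun y => complex.Re (f y)) //;
    apply/funext => y; rewrite ReJ.
- rewrite ImJ (_ : (fun y => _) = - (fun y => complex.Im (f y))).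
    exact: is_deriveN.
  by apply/funext => y; rewrite ImJ.
Qed.

Lemma is_derive_mx_cst m n (A : 'M[C]_(m, n)) x :
  is_derive_mx (fun=> A) x 0.
Proof. by move=> i j; rewrite mxE; split; exact: is_derive_cst. Qed.

Lemma is_derive_mxM m n p (F : R -> 'M[C]_(m, n)) (G : R -> 'M[C]_(n, p)) x D E :
  is_derive_mx F x D -> is_derive_mx G x E ->
  is_derive_mx (fun y => F y *m G y) x (D *m G x + F x *m E).
Proof.
move=> dF dG i j; rewrite !mxE -big_split /=.
under eq_fun do rewrite mxE.
under [X in _ /\ is_derive _ _ X _]eq_fun do rewrite mxE.
apply: (@is_derive_complex_sum _ (fun k y => F y i k * G y k j)) => k.
exact: is_derive_complexM.
Qed.

Lemma is_derive_mx0_is_cst m n (F : R -> 'M[C]_(m, n)) x y :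
  (forall z, is_derive_mx F z 0) -> F x = F y.
Proof.
move=> dF; apply/matrixP => i j; apply/eqP; rewrite eq_complex.
apply/andP; split; apply/eqP.
- by apply: (is_derive_0_is_cst (f := fun y => complex.Re (F y i j))) => z;
    have := dF z i j; rewrite mxE => -[].
- by apply: (is_derive_0_is_cst (f := fun y => complex.Im (F y i j))) => z;
    have := dF z i j; rewrite mxE => -[].
Qed.

End Calculus.

(** * Entrywise limits of matrix products *)

Section Limits.
Local Open Scope classical_set_scope.
Local Open Scope ring_scope.
Local Open Scope complex_scope.
Local Open Scope sesquilinear_scope.
Variables (R : realType) (I : Type) (F : set_system I).
Context {FF : Filter F}.
Local Notation C := R[i].

Lemma cvg_mx_coord m n (f : I -> 'M[C]_(m, n)) (l : 'M[C]_(m, n)) i j :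
  f x @[x --> F] --> l -> f x i j @[x --> F] --> l i j.
Proof.
move=> h; apply: (cvg_comp f (fun M : 'M[C]_(m, n) => M i j) h).
exact: (@coord_continuous C).
Qed.

(** Working entry by entry reduces limits of products to finite sums of products of scalar
    limits. *)
Definition cvg_entries m n (f : I -> 'M[C]_(m, n)) (l : 'M[C]_(m, n)) :=
  forall i j, f x i j @[x --> F] --> l i j.

Lemma cvg_entriesM m n p (f : I -> 'M[C]_(m, n)) (g : I -> 'M[C]_(n, p)) l k :
  cvg_entries f l -> cvg_entries g k ->
  cvg_entries (fun x => f x *m g x) (l *m k).
Proof.
move=> fl gk i j; rewrite mxE.
under eq_fun do rewrite mxE.
apply: (@cvg_big C _ +%R 0 xpredT _ I F _ (fun s x => f x i s * g x s j)
  (fun s => l i s * k s j)) => [|s _]; last exact: cvgM.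
exact: (@add_continuous C^o).
Qed.

Lemma cvg_entries_sandwich n (f g : I -> 'M[C]_n) (M : 'M[C]_n) :
  cvg_entries f 1%:M -> cvg_entries g 1%:M ->
  cvg_entries (fun x => f x *m M *m g x) M.
Proof.
move=> f1 g1; have cM : cvg_entries (fun=> M) M by move=> i j; exact: cvg_cst.
by have := cvg_entriesM (cvg_entriesM f1 cM) g1; rewrite mulmx1 mul1mx.
Qed.

End Limits.

Lemma invmx_left (K : comUnitRingType) n (A B : 'M[K]_n) :
  B *m A = 1%:M -> invmx A = B.
Proof.
move=> BA; have [_ uA] := mulmx1_unit BA.
by rewrite -[B](mulmxK uA) BA mul1mx.
Qed.

(** * Algebra of matrices in nine blocks *)

Section Block3.

Lemma block3_inj (K : nmodType) (A11 A12 A13 A21 A22 A23 A31 A32 A33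
    B11 B12 B13 B21 B22 B23 B31 B32 B33 : 'M[K]_3) :
  block3 A11 A12 A13 A21 A22 A23 A31 A32 A33 =
  block3 B11 B12 B13 B21 B22 B23 B31 B32 B33 ->
  [/\ [/\ A11 = B11, A12 = B12 & A13 = B13],
      [/\ A21 = B21, A22 = B22 & A23 = B23]
    & [/\ A31 = B31, A32 = B32 & A33 = B33]].
Proof.
by move=> /eq_block_mx[/eq_block_mx[-> -> -> ->] /eq_col_mx[-> ->]
  /eq_row_mx[-> ->] ->].
Qed.

Lemma tr_block3 (K : nmodType)
    (A11 A12 A13 A21 A22 A23 A31 A32 A33 : 'M[K]_3) :
  (block3 A11 A12 A13 A21 A22 A23 A31 A32 A33)^T =
  block3 A11^T A21^T A31^T A12^T A22^T A32^T A13^T A23^T A33^T.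
Proof. by rewrite /block3 !tr_block_mx tr_col_mx tr_row_mx. Qed.

Lemma map_block3 (K L : nmodType) (f : K -> L)
    (A11 A12 A13 A21 A22 A23 A31 A32 A33 : 'M[K]_3) :
  map_mx f (block3 A11 A12 A13 A21 A22 A23 A31 A32 A33) =
  block3 (map_mx f A11) (map_mx f A12) (map_mx f A13)
         (map_mx f A21) (map_mx f A22) (map_mx f A23)
         (map_mx f A31) (map_mx f A32) (map_mx f A33).
Proof. by rewrite /block3 !map_block_mx map_col_mx map_row_mx. Qed.

Lemma mul_block3 (K : pzSemiRingType) (A11 A12 A13 A21 A22 A23 A31 A32 A33
    B11 B12 B13 B21 B22 B23 B31 B32 B33 : 'M[K]_3) :
  block3 A11 A12 A13 A21 A22 A23 A31 A32 A33 *m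
  block3 B11 B12 B13 B21 B22 B23 B31 B32 B33 =
  block3
   (A11 *m B11 + A12 *m B21 + A13 *m B31)
   (A11 *m B12 + A12 *m B22 + A13 *m B32)
   (A11 *m B13 + A12 *m B23 + A13 *m B33)
   (A21 *m B11 + A22 *m B21 + A23 *m B31)
   (A21 *m B12 + A22 *m B22 + A23 *m B32)
   (A21 *m B13 + A22 *m B23 + A23 *m B33)
   (A31 *m B11 + A32 *m B21 + A33 *m B31)
   (A31 *m B12 + A32 *m B22 + A33 *m B32)
   (A31 *m B13 + A32 *m B23 + A33 *m B33).
Proof.
rewrite /block3 mulmx_block mulmx_block mul_col_row add_block_mx.
rewrite mul_block_col mul_col_mx add_col_mx mul_row_block mul_mx_row.
by rewrite add_row_mx mul_row_col.
Qed.

Lemma mul_diag_block3 (K : pzSemiRingType) (U1 U2 U3 V1 V2 V3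
    A11 A12 A13 A21 A22 A23 A31 A32 A33 : 'M[K]_3) :
  block3 U1 0 0 0 U2 0 0 0 U3 *m
  block3 A11 A12 A13 A21 A22 A23 A31 A32 A33 *m
  block3 V1 0 0 0 V2 0 0 0 V3 =
  block3 (U1 *m A11 *m V1) (U1 *m A12 *m V2) (U1 *m A13 *m V3)
         (U2 *m A21 *m V1) (U2 *m A22 *m V2) (U2 *m A23 *m V3)
         (U3 *m A31 *m V1) (U3 *m A32 *m V2) (U3 *m A33 *m V3).
Proof. by rewrite !mul_block3 !(mulmx0, mul0mx, addr0, add0r). Qed.

Lemma opp_block3 (K : zmodType)
    (A11 A12 A13 A21 A22 A23 A31 A32 A33 : 'M[K]_3) :
  - block3 A11 A12 A13 A21 A22 A23 A31 A32 A33 =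
  block3 (- A11) (- A12) (- A13) (- A21) (- A22) (- A23)
         (- A31) (- A32) (- A33).
Proof. by rewrite /block3 !opp_block_mx opp_col_mx opp_row_mx. Qed.

Lemma block3_1 (K : pzSemiRingType) :
  block3 (1%:M : 'M[K]_3) 0 0 0 1%:M 0 0 0 1%:M = 1%:M.
Proof.
by rewrite /block3 -scalar_mx_block col_mx0 row_mx0 -scalar_mx_block.
Qed.

End Block3.

(** * Identities for [s1], [S0], [J], [A1] and [expiJ] *)

Section Constants.
Variable R : realType.
Local Notation C := R[i].


Ltac mx3_tac :=
  apply/matrixP => -[[|[|[|//]]] ?] [[|[|[|//]]] ?];
  rewrite !mxE ?big_ord_recl ?big_ord0 ?mxE /= ?(mulr0, mul0r, mulr1, mul1r,
   mulrNN, mulrN, mulNr, addr0, add0r, oppr0).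

Lemma s1K : s1 R *m s1 R = 1%:M.
Proof. by mx3_tac. Qed.

Lemma tr_s1 : (s1 R)^T = s1 R.
Proof. by mx3_tac. Qed.

Lemma mul_tr_a1 : (a1 R)^T *m a1 R = 1%:M.
Proof. by mx3_tac. Qed.

Lemma mul_tr_a2 : (a2 R)^T *m a2 R = 1%:M.
Proof. by mx3_tac. Qed.

Lemma mul_tr_a3 : (a3 R)^T *m a3 R = 1%:M.
Proof. by mx3_tac. Qed.

Let block3_simp :=
  (mulmx0, mul0mx, addr0, add0r, mulmx1, mul1mx, mulmxN, mulNmx, @opprK, @oppr0,
   trmx0, trmx1, tr_scalar_mx, tr_s1, s1K, mul_tr_a1, mul_tr_a2, mul_tr_a3).

Lemma S0K : S0 R *m S0 R = 1%:M.
Proof. by rewrite /S0 mul_block3 !block3_simp block3_1. Qed.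

Lemma mul_tr_A1 : (A1 R)^T *m A1 R = 1%:M.
Proof. by rewrite /A1 tr_block3 mul_block3 !block3_simp block3_1. Qed.

(** [S0] is block antidiagonal, so the order of block rows and of block columns is reversed. Its
    middle block is [- s1], whence a sign on the blocks with exactly one index equal to 2. *)
Lemma S0_sandwich (A11 A12 A13 A21 A22 A23 A31 A32 A33 : 'M[C]_3) :
  let s := s1 R in
  S0 R *m block3 A11 A12 A13 A21 A22 A23 A31 A32 A33 *m S0 R =
  block3 (s *m A33 *m s)     (- (s *m A32 *m s)) (s *m A31 *m s)
         (- (s *m A23 *m s)) (s *m A22 *m s)     (- (s *m A21 *m s))
         (s *m A13 *m s)     (- (s *m A12 *m s)) (s *m A11 *m s).
Proof.
rewrite /S0; move: (s1 R) => s /=.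
by rewrite !mul_block3 !(mulmx0, mul0mx, addr0, add0r) !(mulmxN, mulNmx, opprK).
Qed.

(** Each of [a1], [a2], [a3] is a signed permutation matrix, so inversion is transposition, both for
    the blocks and for [A1]. *)
Lemma invmx_A1 :
  invmx (A1 R) = block3 (invmx (a1 R)) 0 0 0 (invmx (a2 R)) 0 0 0 (invmx (a3 R)).
Proof.
rewrite (invmx_left mul_tr_A1) (invmx_left mul_tr_a1) (invmx_left mul_tr_a2).
by rewrite (invmx_left mul_tr_a3) /A1 tr_block3 !trmx0.
Qed.

(** [S0] exchanges the first and third blocks, on which [J] takes opposite values, and [J] vanishes
    on the middle one. *)
Lemma mulJS0 : J R *m S0 R = - (S0 R *m J R).
Proof.
by rewrite /J /S0 !mul_block3 opp_block3 !block3_simp.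
Qed.

Lemma mulJA1 : J R *m A1 R = A1 R *m J R.
Proof. by rewrite /J /A1 !mul_block3 !block3_simp. Qed.

Lemma tr_J : (J R)^T = J R.
Proof. by rewrite /J tr_block3 linearN /= !block3_simp. Qed.

Lemma conj_J : map_mx Num.conj (J R) = J R.
Proof. by rewrite /J map_block3 map_mxN !map_mx0 !map_mx1. Qed.

Lemma cisN (t : R) : cis (- t) = Num.conj (cis t).
Proof. by rewrite /cis cosN sinN. Qed.

Lemma mul_cis_conj (t : R) : cis t * Num.conj (cis t) = 1.
Proof.
rewrite -normCK; apply/eqP; rewrite /cis normc_def /=.
by rewrite -rmorphXn /= cos2Dsin2 sqrtr1 expr1n.
Qed.

Lemma norm_cis (t : R) : `|cis t| = 1.
Proof. by rewrite /cis normc_def /= cos2Dsin2 sqrtr1. Qed.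

Lemma cis_sandwich (t : R) (M : 'M[C]_3) :
  (cis t)%:M *m M *m (cis (- t))%:M = M.
Proof.
by rewrite mul_scalar_mx mul_mx_scalar scalerA cisN mulrC mul_cis_conj scale1r.
Qed.

(* Scalar matrices are generalized to variables before simplification: deciding
   whether [(cis t)%:M] or [1%:M] unifies with [0] makes the unifier diverge. *)
Lemma expiJ_S0 (t : R) : (expiJ t)^T *m S0 R *m expiJ t = S0 R.
Proof.
(* The nonzero blocks of [S0] sit at (1,3), (3,1) and (2,2), where the left and right phases are
   mutually inverse: [UV], [VU] and [WW] treat them in this order. *)
have UV := cis_sandwich t; have VU := cis_sandwich (- t); rewrite opprK in VU.
have WW (M : 'M[C]_3) : 1%:M *m M *m 1%:M = M by rewrite mul1mx mulmx1.
rewrite /expiJ /S0 tr_block3 !tr_scalar_mx !trmx0.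
move: (cis t)%:M (cis (- t))%:M 1%:M (s1 R) UV VU WW => U V W s UV VU WW.
by rewrite mul_diag_block3 UV VU WW !(mulmx0, mul0mx).
Qed.

(** [expiJ] is scalar on each block, so it commutes with [M], and it is unitary. This serves both
    [M = 1] and [M = A1]. *)
Lemma expiJ_block_diag (t : R) (B1 B2 B3 : 'M[C]_3) :
  let M := block3 B1 0 0 0 B2 0 0 0 B3 in
  (expiJ t)^t* *m M *m expiJ t = M.
Proof.
have UV := cis_sandwich t; have VU := cis_sandwich (- t); rewrite opprK in VU.
have WW (M : 'M[C]_3) : 1%:M *m M *m 1%:M = M by rewrite mul1mx mulmx1.
rewrite /= /expiJ tr_block3 map_block3 !tr_scalar_mx !map_scalar_mx /= -!cisN.
rewrite opprK !trmx0 !map_mx0 rmorph1.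
move: (cis t)%:M (cis (- t))%:M 1%:M UV VU WW => U V W UV VU WW.
by rewrite mul_diag_block3 UV VU WW !(mulmx0, mul0mx).
Qed.

(** Multiplication by such a matrix, on either side, preserves the modulus of every entry. *)
Lemma expiJ_diag (t : R) :
  exists2 d : 'rV[C]_(3 + 3 + 3), expiJ t = diag_mx d & forall j, `|d 0 j| = 1.
Proof.
pose c3 z : 'rV[C]_3 := const_mx z.
exists (row_mx (row_mx (c3 (cis t)) (c3 1)) (c3 (cis (- t)))).
  by rewrite !diag_mx_row !diag_const_mx /expiJ /block3 col_mx0 row_mx0.
by move=> j; rewrite mxE; case: split_ordP => k _; rewrite mxE;
  [case: split_ordP => l _; rewrite mxE|]; rewrite ?norm_cis ?normr1.
Qed.

End Constants.

(** * The conserved form [chi^s M chi] and its value *)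

Section Invariants.
Local Open Scope classical_set_scope.
Local Open Scope ring_scope.
Local Open Scope complex_scope.
Local Open Scope sesquilinear_scope.
Variable R : realType.
Local Notation C := R[i].
Variable s : {rmorphism C -> C}.
Hypothesis norm_s : forall z, `|s z| = `|z|.
Hypothesis derive_s : forall f x d, is_derive_complex f x d ->
  is_derive_complex (fun y => s (f y)) x (s d).

Lemma cvg_entries_trmap (I : Type) (F : set_system I) (FF : Filter F) m n
    (f : I -> 'M[C]_(m, n)) l :
  cvg_entries F f l -> cvg_entries F (fun x => map_mx s (f x)^T) (map_mx s l^T).
Proof.
move=> fl i j; rewrite !mxE; under eq_fun do rewrite !mxE.
apply/cvgrPdist_lt => e e0; move/cvgrPdist_lt : (fl j i) => /(_ e e0).
by apply: filterS => x; rewrite -rmorphB norm_s.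
Qed.

Lemma is_derive_trmap m n (f : R -> 'M[C]_(m, n)) x d :
  is_derive_mx f x d ->
  is_derive_mx (fun y => map_mx s (f y)^T) x (map_mx s d^T).
Proof.
move=> df i j; rewrite !mxE.
have := derive_s (df j i); rewrite /is_derive_complex.
rewrite (_ : (fun y => complex.Re (s (f y j i))) =
  (fun y => complex.Re (map_mx s (f y)^T i j))); last first.
  by apply/funext => y; rewrite !mxE.
rewrite (_ : (fun y => complex.Im (s (f y j i))) =
  (fun y => complex.Im (map_mx s (f y)^T i j))) //.
by apply/funext => y; rewrite !mxE.
Qed.

(* [expiJ] oscillates, so [chi] itself has no limit; but [expiJ] is diagonal with
   unimodular entries, so the modulus of each entry of [N - M] is unchanged when
   [chi] is replaced by [chi *m expiJ], which tends to [1]. *)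
Lemma unimodular_limit (F : set_system R) (FF : ProperFilter F) (lambda : R)
    (chi : R -> 'M[C]_(3 + 3 + 3)) (M N : 'M[C]_(3 + 3 + 3)) :
  chi x *m expiJ (lambda * x) @[x --> F] --> (1%:M : 'M[C]_(3 + 3 + 3)) ->
  (forall t : R, map_mx s (expiJ t)^T *m M *m expiJ t = M) ->
  (forall x, map_mx s (chi x)^T *m M *m chi x = N) -> N = M.
Proof.
move=> chi1 EM chiN; apply/eqP; rewrite -subr_eq0; apply/eqP/matrixP => i j.
rewrite [RHS]mxE.
pose X x := chi x *m expiJ (lambda * x).
have X1 : cvg_entries F X 1%:M by move=> k l; apply: cvg_mx_coord.
have XM : cvg_entries F (fun x => map_mx s (X x)^T *m M *m X x) M.
  have Xs : cvg_entries F (fun x => map_mx s (X x)^T) 1%:M.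
    have := cvg_entries_trmap _ X1; rewrite trmx1 map_mx1; exact.
  exact: cvg_entries_sandwich Xs X1.
have XN x : `|M i j - (map_mx s (X x)^T *m M *m X x) i j| = `|(N - M) i j|.
  have [d Ed d1] := expiJ_diag (lambda * x).
  have -> : map_mx s (X x)^T *m M *m X x =
      map_mx s (expiJ (lambda * x))^T *m N *m expiJ (lambda * x).
    by rewrite -(chiN x) /X trmx_mul map_mxM !mulmxA.
  (* By invariance [M] is written as its own sandwich between the exponentials. Entry (i,j) of the
     difference is then that of [M - N] times the unimodular factors [s d_i] and [d_j]. *)
  rewrite -[in LHS](EM (lambda * x)) Ed tr_diag_mx map_diag_mx.
  rewrite !mul_mx_diag !mul_diag_mx !mxE -!mulrBl -mulrBr !normrM norm_s !d1.
  by rewrite mul1r mulr1 distrC.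
(* By [XN] the distance of the entry to its limit does not depend on [x]. Were it positive, it could
   itself be taken as the bound in [XM], and at some point it would be smaller than itself. *)
apply/eqP; rewrite -normr_eq0; apply/negPn/negP => N0.
have e0 : 0 < `|(N - M) i j| by rewrite lt_neqAle eq_sym N0 normr_ge0.
move/cvgrPdist_lt : (XM i j) => /(_ _ e0) /filter_ex [x].
by rewrite XN ltxx.
Qed.

(** Since [chi' = 'i H chi], the derivative of the form is the expression assumed to vanish, placed
    between [chi^s] and [chi]. The filter [F] is left abstract so that either end of the line can
    supply the normalization. *)
Lemma jost_invariant (Q : R -> 'M[C]_(3 + 3 + 3)) (lambda : R)
    (chi : R -> 'M[C]_(3 + 3 + 3)) (M : 'M[C]_(3 + 3 + 3))
    (F : set_system R) (FF : ProperFilter F) :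
  fundamental_solution Q lambda chi ->
  chi x *m expiJ (lambda * x) @[x --> F] --> (1%:M : 'M[C]_(3 + 3 + 3)) ->
  (forall t : R, map_mx s (expiJ t)^T *m M *m expiJ t = M) ->
  (forall x, let H := Q x - lambda%:C *: J R in
     s 'i *: (map_mx s H^T *m M) + 'i *: (M *m H) = 0) ->
  forall x, map_mx s (chi x)^T *m M *m chi x = M.
Proof.
move=> [dchi _] chi1 EM HM x.
pose W y := map_mx s (chi y)^T *m M *m chi y.
apply: (unimodular_limit _ chi1 EM) => {}y.
apply: (is_derive_mx0_is_cst (F := W)) => z.
have [D chiD] := dchi z; set H := Q z - _ => DH.
(* The differential equation is solved for the derivative by multiplying it by ['i]. *)
have {}DH : D = 'i *: (H *m chi z).
  have ii : 'i * 'i = -1 :> C by rewrite -expr2 sqr_i.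
  move/(congr1 ( *:%R 'i)): DH; rewrite scaler0 scalerDr scalerA ii scaleN1r.
  by rewrite addrC => /eqP; rewrite subr_eq0 => /eqP.
have dcst := is_derive_mx_cst M z.
have := is_derive_mxM (is_derive_mxM (is_derive_trmap chiD) dcst) chiD.
rewrite mulmx0 addr0 DH linearZ /= map_mxZ trmx_mul map_mxM.
rewrite (_ : _ + _ = map_mx s (chi z)^T *m
  (s 'i *: (map_mx s H^T *m M) + 'i *: (M *m H)) *m chi z).
  by rewrite HM mulmx0 mul0mx.
by rewrite mulmxDr mulmxDl -!scalemxAl -!scalemxAr -!scalemxAl !mulmxA.
Qed.

Lemma scattering_invariant (Q : R -> 'M[C]_(3 + 3 + 3)) phi psi
    (M : 'M[C]_(3 + 3 + 3)) :
  is_jost_phi Q phi -> is_jost_psi Q psi ->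
  (forall t : R, map_mx s (expiJ t)^T *m M *m expiJ t = M) ->
  (forall x lambda : R, let H := Q x - lambda%:C *: J R in
     s 'i *: (map_mx s H^T *m M) + 'i *: (M *m H) = 0) ->
  forall x lambda, let T := scattering_matrix phi psi x lambda in
    map_mx s T^T *m M *m T = M.
Proof.
move=> hphi hpsi EM HM x lambda /=.
have [fphi lphi] := hphi lambda; have [fpsi lpsi] := hpsi lambda.
have phiM : map_mx s (phi x lambda)^T *m M *m phi x lambda = M.
  exact: (jost_invariant _ fphi lphi EM (HM^~ lambda) x).
have psiM : map_mx s (psi x lambda)^T *m M *m psi x lambda = M.
  exact: (jost_invariant _ fpsi lpsi EM (HM^~ lambda) x).
(* Substituting [phi = psi T] turns [phiM] into [T^s (psi^s M psi) T = M], whose inner factor is [M]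
   by [psiM]. *)
have := phiM; rewrite -{1 2}[phi x lambda](mulKVmx (fpsi.2 x)).
rewrite -/(scattering_matrix _ _ _ _); set T := scattering_matrix _ _ _ _.
by rewrite trmx_mul map_mxM mulmxA -!(mulmxA (map_mx s T^T)) psiM mulmxA.
Qed.

End Invariants.

(** * The symmetries of the scattering matrix *)

Section Symmetries.
Variables (R : realType) (Q : R -> 'M[R[i]]_(3 + 3 + 3)).
Variables phi psi : R -> R -> 'M[R[i]]_(3 + 3 + 3).
Hypotheses (hphi : is_jost_phi Q phi) (hpsi : is_jost_psi Q psi).
Local Notation C := R[i].
Local Notation T := (scattering_matrix phi psi).

(** As [S0] is its own inverse, membership in so(9) multiplied by [S0] reads [S0 Q + Q^T S0 = 0].
    The [lambda] terms cancel because [J] is symmetric and anticommutes with [S0]. *)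
Lemma scattering_so9 : (forall x, in_so9 (Q x)) ->
  forall x lambda, (T x lambda)^T *m S0 R *m T x lambda = S0 R.
Proof.
(* The identity map is inserted to match the general statement at [s = idfun]. *)
move=> so9 x lambda; rewrite -[(T x lambda)^T](map_mx_id (fun=> erefl)).
apply: (scattering_invariant (s := idfun) _ _ hphi hpsi) => // [t|y l /=].
  by rewrite map_mx_id // expiJ_S0.
rewrite map_mx_id // -scalerDr linearB /= linearZ /= tr_J mulmxBl mulmxBr.
rewrite -scalemxAl -scalemxAr mulJS0 scalerN opprK addrACA subrr addr0.
have := so9 y; rewrite /in_so9 (invmx_left (S0K R)) => /(congr1 (mulmx (S0 R))).
rewrite mulmxDr !mulmxA S0K mul1mx mulmx0 [X in 'i *: X]addrC => ->.
exact: scaler0.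
Qed.

(** Reality of [lambda] enters here, along with [J] being real and symmetric. *)
Lemma herm_reduced (lambda : R) x : Q x = (Q x)^t* ->
  (Q x - lambda%:C *: J R)^t* = Q x - lambda%:C *: J R.
Proof.
move=> hQ; rewrite linearB /= linearZ /= tr_J map_mxB map_mxZ conj_J -hQ.
by congr (_ - _ *: _); exact: conjc_real.
Qed.

(** Conjugation sends ['i] to [- 'i] and [H] is Hermitian, so the condition on [M] becomes
    ['i (M H - H M) = 0], that is, commutation with [H]. *)
Lemma scattering_conj_comm (M : 'M[C]_(3 + 3 + 3)) :
  (forall x, Q x = (Q x)^t*) -> (forall x, Q x *m M = M *m Q x) ->
  J R *m M = M *m J R ->
  (forall t, (expiJ t)^t* *m M *m expiJ t = M) ->
  forall x lambda, (T x lambda)^t* *m M *m T x lambda = M.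
Proof.
move=> hQ QM JM EM x lambda.
apply: (scattering_invariant (s := Num.conj) _ _ hphi hpsi) => // [z|f y d|y l /=].
- exact: norm_conjC.
- exact: is_derive_complex_conj.
rewrite (herm_reduced _ (hQ y)) mulmxBl mulmxBr -scalemxAl -scalemxAr JM QM.
rewrite -scalerDl (_ : Num.conj 'i = - 'i) ?addNr ?scale0r //.
by rewrite /Num.conj /= /GRing.opp /= oppr0.
Qed.

End Symmetries.

(** * Assembly of the symmetries and passage to blocks *)

Theorem mainTheorem3 (R : realType)
    (Q : R -> 'M[R[i]]_(3 + 3 + 3))
    (q p qt pt : R -> 'M[R[i]]_3)
    (hQsmooth : smooth_mx Q)
    (hQdecay : rapidly_decreasing_mx Q)
    (hQso : forall x, in_so9 (Q x))
    (hQblock : forall x, Q x = block3 0     (q x)  0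
                                      (p x) 0      (qt x)
                                      0     (pt x) 0)
    (hQherm : forall x, Q x = (Q x) ^t*)
    (hQA1 : forall x, A1 R *m Q x *m invmx (A1 R) = Q x)
    (phi psi : R -> R -> 'M[R[i]]_(3 + 3 + 3))
    (hphi : is_jost_phi Q phi) (hpsi : is_jost_psi Q psi)
    (T : R -> 'M[R[i]]_(3 + 3 + 3))
    (x0 : R) (hT : forall lambda, T lambda = scattering_matrix phi psi x0 lambda) :
  (forall lambda : R,
    [/\ invmx (T lambda) = S0 R *m (T lambda)^T *m S0 R,
        (T lambda) ^t* = invmx (T lambda)
      & T lambda = A1 R *m T lambda *m invmx (A1 R)]) /\
  (forall mp bm cm bp T22 Bm cp Bp mm : R -> 'M[R[i]]_3,
    (forall lambda : R,
      T lambda = block3 (mp lambda) (- bm lambda) (cm lambda)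
                        (bp lambda) (T22 lambda)  (- Bm lambda)
                        (cp lambda) (Bp lambda)   (mm lambda)) ->
    forall lambda : R,
    [/\ (mp lambda) ^t* = s1 R *m (mm lambda)^T *m s1 R
        /\ (cp lambda) ^t* = s1 R *m (cm lambda)^T *m s1 R,
        (bp lambda) ^t* = s1 R *m (Bm lambda)^T *m s1 R
        /\ (bm lambda) ^t* = s1 R *m (Bp lambda)^T *m s1 R,
        (Bp lambda) ^t* = s1 R *m (bm lambda)^T *m s1 R
        /\ (Bm lambda) ^t* = s1 R *m (bp lambda)^T *m s1 R
      & [/\ [/\ mp lambda = a1 R *m mp lambda *m invmx (a1 R),
                bm lambda = a1 R *m bm lambda *m invmx (a2 R)
              & cm lambda = a1 R *m cm lambda *m invmx (a3 R)],
            [/\ bp lambda = a2 R *m bp lambda *m invmx (a1 R),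
                T22 lambda = a2 R *m T22 lambda *m invmx (a2 R)
              & Bm lambda = a2 R *m Bm lambda *m invmx (a3 R)]
          & [/\ cp lambda = a3 R *m cp lambda *m invmx (a1 R),
                Bp lambda = a3 R *m Bp lambda *m invmx (a2 R)
              & mm lambda = a3 R *m mm lambda *m invmx (a3 R)]]]).

Proof.
have so9 lambda : (T lambda)^T *m S0 R *m T lambda = S0 R.
  by rewrite hT; exact: scattering_so9.
have unit lambda : (T lambda)^t* *m T lambda = 1%:M.
  (* Unitarity is the case [M = 1], so an identity factor is inserted in the middle. *)
  rewrite -[X in X *m _]mulmx1 hT.
  apply: scattering_conj_comm => // [x||t].
  - by rewrite mulmx1 mul1mx.
  - by rewrite mulmx1 mul1mx.
  - by rewrite -block3_1 expiJ_block_diag.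
have uA1 : A1 R \in unitmx by have [] := mulmx1_unit (mul_tr_A1 R).
have TA1 lambda : T lambda = A1 R *m T lambda *m invmx (A1 R).
  have : (T lambda)^t* *m A1 R *m T lambda = A1 R.
    rewrite hT; apply: scattering_conj_comm => // [x||t].
    - by rewrite -[in LHS](hQA1 x) mulmxKV.
    - exact: mulJA1.
    - exact: expiJ_block_diag.
  (* Multiplying on the left by [T], the inverse of its Hermitian conjugate, leaves
     [A1 T = T A1]. *)
  move=> /(congr1 (mulmx (T lambda))).
  rewrite !mulmxA (mulmx1C (unit lambda)) mul1mx => ->.
  by rewrite mulmxK.
have Tinv lambda : invmx (T lambda) = S0 R *m (T lambda)^T *m S0 R.
  by apply: invmx_left; rewrite -2!mulmxA so9 S0K.
split=> [lambda|mp bm cm bp T22 Bm cp Bp mm TE lambda].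
  by split; [exact: Tinv|rewrite (invmx_left (unit lambda))|exact: TA1].
(* Combining the first two symmetries gives [T^t* = S0 T^T S0], to be compared block by block. The
   minus signs before [bm] and [Bm] offset those produced by [S0_sandwich]. *)
have := Tinv lambda; rewrite (invmx_left (unit lambda)) TE tr_block3 map_block3.
rewrite S0_sandwich !(linearN, map_mxN) /= !(mulmxN, mulNmx, opprK).
move=> /block3_inj[[mE bE cE] [/oppr_inj b'E _ BE] [_ /oppr_inj B'E _]].
(* Conjugation by the block diagonal [A1] acts on each block separately: block (i,j) is multiplied
   by [a_i] on the left and by the inverse of [a_j] on the right. *)
have := TA1 lambda; rewrite TE invmx_A1 mul_diag_block3 !(mulmxN, mulNmx).
by move=> /block3_inj[[? /oppr_inj ? ?] [? ? /oppr_inj ?] [? ? ?]].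
Qed.
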